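(* Let $(N,\langle\,,\,\rangle)$ be a 2-step nilpotent Lie group equipped with a left-invariant metric, with Lie algebra $\mathfrak n=\mathfrak v\oplus\mathfrak z$, and let $q\in\mathbb R\setminus\{0\}$. Let $y(t)=v(t)+z(t)$ be a differentiable curve in $\mathfrak n$, with $v(t)\in\mathfrak v$, $z(t)\in\mathfrak z$, and write $y(0)=X_0+Z_0$ with $X_0\in\mathfrak v$, $Z_0\in\mathfrak z$. The following statements are equivalent: (i) there is $\widetilde Z\in C(\mathfrak n)$ such that $y(t)$ is a magnetic trajectory on $\mathfrak n$ for $F=j(\widetilde Z)$; (ii) there is $\widetilde Z\in C(\mathfrak n)$ such that $y(t)=x(t)-q\widetilde Z$, where $x(t)$ is the geodesic on $\mathfrak n$ with initial condition $x(0)=X_0+Z_0+q\widetilde Z$; (iii) the curve $y(t)=v(t)+z(t)$ satisfies: (a) $z(t)$ is constant, $z(t)\equiv Z_0$; (b) $v'(t)=Rv(t)$ for some $R\in\mathfrak{so}(\mathfrak v)$; and (c) $R$ belongs to the image of $j$.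
   Context: All Lie groups and Lie algebras are real. A Lie algebra $\mathfrak n$ is 2-step nilpotent if $[[U,V],W]=0$ for all $U,V,W\in\mathfrak n$. The left-invariant metric on $N$ is identified with an inner product $\langle\,,\,\rangle$ on $\mathfrak n$. $\mathfrak z$ is the center of $\mathfrak n$, $\mathfrak v=\mathfrak z^\perp$, and $C(\mathfrak n)=[\mathfrak n,\mathfrak n]\subseteq\mathfrak z$ is the commutator. The linear map $j:\mathfrak z\to\mathfrak{so}(\mathfrak v)$ is defined by $\langle Z,[V,W]\rangle=\langle j(Z)V,W\rangle$ for $Z\in\mathfrak z$, $V,W\in\mathfrak v$. For $\widetilde Z\in C(\mathfrak n)$, $F=j(\widetilde Z)$ is regarded as a skew-symmetric map $\mathfrak n\to\mathfrak n$ by setting it equal to $0$ on $\mathfrak z$ (these are the left-invariant Lorentz forces called exact). A curve $x(t)$ in $\mathfrak n$ is a magnetic trajectory on $\mathfrak n$ for $F$ (with the fixed charge $q$) if $x'(t)=\operatorname{ad}(x(t))^*(x(t))+qF x(t)$, where $\operatorname{ad}(x)^*$ is the adjoint of $\operatorname{ad}(x):\mathfrak n\to\mathfrak n$ with respect to $\langle\,,\,\rangle$. A geodesic on $\mathfrak n$ is a solution of the same equation with $F=0$; for $x(t)=v(t)+z(t)\in\mathfrak v\oplus\mathfrak z$ the geodesic equation reads $v'(t)=j(z(t))v(t)$, $z'(t)=0$. *)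

(* Defs.v *)
From HB Require Import structures.
From mathcomp Require Import all_boot all_order all_algebra.
From mathcomp Require Import sesquilinear.
From mathcomp Require Import boolp classical_sets reals topology normedtype derive.

Set Implicit Arguments.
Unset Strict Implicit.
Unset Printing Implicit Defensive.

Import Order.TTheory GRing.Theory Num.Theory.
Import numFieldNormedType.Exports.

Local Open Scope classical_set_scope.
Local Open Scope ring_scope.

(* Finite-dimensional normed spaces: the [vectType] part provides subspaces and
   linear maps, the norm provides the topology used to differentiate curves. *)
#[short(type="finNormedModType")]
HB.structure Definition FinNormedModule (K : numDomainType) :=
  {V of NormedModule K V & Vector K V}.

Record lieBracket (K : fieldType) (g : lmodType K) := LieBracket {
  lie_fun :> {bilinear g -> g -> g};
  lie_alt : forall x, lie_fun x x = 0;
  lie_jacobi : forall x y w,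
    lie_fun x (lie_fun y w) + lie_fun y (lie_fun w x)
    + lie_fun w (lie_fun x y) = 0
}.

Definition two_step_nilpotent (K : fieldType) (g : lmodType K)
    (br : lieBracket g) : Prop :=
  forall x y w, br (br x y) w = 0.

Section LieSubspaces.
Variables (K : fieldType) (g : vectType K) (br : lieBracket g).

Definition ad (x : g) : 'End(g) := linfun (br x).

Lemma adE x y : ad x y = br x y.
Proof. by rewrite lfunE. Qed.

Definition lie_center : {vspace g} :=
  (\bigcap_(i < \dim {:g}) lker (ad (vbasis {:g})`_i))%VS.

Lemma lie_centerP (x : g) :
  reflect (forall y, br x y = 0) (x \in lie_center).
Proof.
have altN y w : br y w = - br w y.
  apply/eqP; rewrite -addr_eq0; apply/eqP.
  have := lie_alt br (y + w).
  by rewrite linearDl !linearDr !lie_alt add0r addr0.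
apply: (iffP idP) => [/subv_bigcapP xz y|xz]; last first.
  apply/subv_bigcapP => i _.
  by rewrite -memvE memv_ker adE altN xz oppr0.
rewrite (coord_vbasis (memvf y)) linear_sumr big1// => i _.
rewrite linearZr_LR /= altN.
have := xz i isT; rewrite -memvE memv_ker adE => /eqP ->.
by rewrite oppr0 scaler0.
Qed.

(* The linear span of all brackets; by bilinearity, brackets of basis vectors
   suffice, as in [prodv]. *)
Definition lie_commutator : {vspace g} :=
  <<[seq br x y | x <- vbasis {:g}, y <- vbasis {:g}]>>%VS.

Lemma lie_commutatorP (U : {vspace g}) :
  reflect (forall x y, br x y \in U) (lie_commutator <= U)%VS.
Proof.
apply: (iffP span_subvP) => [sU x y|sU _ /allpairsP[p [_ _ ->]]]; last first.
  exact: sU.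
rewrite (coord_vbasis (memvf x)) linear_sumlz memv_suml// => i _.
rewrite linearZl_LR memvZ// (coord_vbasis (memvf y)) linear_sumr.
rewrite memv_suml// => k _; rewrite linearZr_LR memvZ// sU//.
by apply/allpairsP; exists ((vbasis {:g})`_i, (vbasis {:g})`_k);
  split; rewrite //= mem_nth// size_tuple.
Qed.

End LieSubspaces.

Section Representation.
Variables (K : fieldType) (W : vectType K) (b : W -> W -> K).
Hypothesis b_linl : forall w, scalar (b ^~ w).
Hypothesis b_linr : forall w, scalar (b w).
Hypothesis b_def : forall w, b w w = 0 -> w = 0.

Let row_of (u : W) : 'rV[K]_(\dim {:W}) := \row_i b u (vbasis {:W})`_i.

Let row_of_linear : linear row_of.
Proof. by move=> a u v; apply/rowP => i; rewrite !mxE b_linl. Qed.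

HB.instance Definition _ :=
  GRing.isLinear.Build K W 'rV[K]_(\dim {:W}) _ row_of row_of_linear.

Lemma scalar_sum (phi : W -> K) (w : W) : scalar phi ->
  phi w = \sum_(i < \dim {:W}) coord (vbasis {:W}) i w * phi (vbasis {:W})`_i.
Proof.
move=> phi_lin.
pose phiL : {scalar W} :=
  HB.pack phi (GRing.isLinear.Build K W K *%R phi phi_lin).
rewrite [in LHS](coord_vbasis (memvf w)) -[phi]/(phiL : W -> K).
by rewrite linear_sum; apply: eq_bigr => i _; rewrite linearZ.
Qed.

Lemma definite_repr (phi : W -> K) : scalar phi ->
  exists u, forall w, b u w = phi w.
Proof.
move=> phi_lin.
have ker0 : lker (linfun row_of) == 0%VS.
  rewrite -subv0; apply/subvP => u; rewrite memv_ker lfunE memv0 /=.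
  move=> /eqP/rowP u0; apply/eqP/b_def; rewrite scalar_sum ?b_linr//.
  by rewrite big1// => i _; have := u0 i; rewrite !mxE => ->; rewrite mulr0.
have full : limg (linfun row_of) = fullv.
  apply/eqP; rewrite eqEdim subvf /= limg_dim_eq ?(eqP ker0) ?capv0//.
  by rewrite !dimvf /dim /= mul1n.
have /memv_imgP[u _ hu] : \row_i phi (vbasis {:W})`_i \in limg (linfun row_of).
  by rewrite full memvf.
exists u => w; rewrite scalar_sum ?b_linr// [RHS]scalar_sum//.
apply: eq_bigr => i _; congr (_ * _).
by move/rowP: hu => /(_ i); rewrite lfunE !mxE.
Qed.

Lemma definite_repr_lfun (U : vectType K) (c : U -> W -> K) :
  (forall w, scalar (c ^~ w)) -> (forall u, scalar (c u)) ->
  exists h : 'Hom(U, W), forall u w, b (h u) w = c u w.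
Proof.
move=> c_linl c_linr.
have /choice[h hP] u := definite_repr (c_linr u).
have h_lin : linear h.
  move=> a u v; apply: (addrI (- (a *: h u + h v))); rewrite addNr.
  rewrite -scaleN1r; apply: b_def.
  by rewrite b_linl b_linl !hP c_linl mulN1r addNr.
pose hL : {linear U -> W} := HB.pack h (GRing.isLinear.Build K U W _ h h_lin).
by exists (linfun hL) => u w; rewrite lfunE hP.
Qed.

End Representation.

Section InnerProduct.
Variables (R : realType) (g : vectType R) (ip : {dot g for idfun}).

Lemma ipC x y : ip x y = ip y x.
Proof. by rewrite hermC /= expr0 mul1r. Qed.

Lemma ip_eq0 x : ip x x = 0 -> x = 0.
Proof.
move=> xx; apply/eqP/negP => /negP /(@neq0_dnorm_gt0 _ _ _ ip).
by rewrite xx ltxx.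
Qed.

Lemma ip_linr x : scalar (ip x).
Proof. by move=> a y w; rewrite linearPr. Qed.

Lemma ip_linl y : scalar (ip ^~ y).
Proof. by move=> a x w; rewrite linearPl. Qed.

(* The adjoint with respect to [ip]; see [adjointP]. *)
Definition adjoint (f : 'End(g)) : 'End(g) :=
  xget 0 [set h : 'End(g) | forall x y, ip (f x) y = ip x (h y)].

Lemma adjointP (f : 'End(g)) x y : ip (f x) y = ip x (adjoint f y).
Proof.
rewrite /adjoint; case: xgetP => [h _ /(_ x y)//|].
have [h hP] := @definite_repr_lfun _ _ ip ip_linl ip_linr ip_eq0 g
  (fun y x => ip (f x) y)
  (fun x => ip_linr (f x))
  (fun y a x x' => ltac:(by rewrite /= linearP linearPl)).
by case/(_ h) => x' y'; rewrite [RHS]ipC hP.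
Qed.

Definition so (U : {vspace g}) : set 'End(subvs_of U) :=
  [set A | forall x y, ip (vsval (A x)) (vsval y) = - ip (vsval x) (vsval (A y))].

End InnerProduct.

Section TwoStep.
Variables (R : realType) (g : vectType R) (br : lieBracket g).
Variable ip : {dot g for idfun}.

Local Notation z := (lie_center br).
Local Notation v := (orthov ip (lie_center br)).

(* The map j; only its values at elements of the center are meaningful.
   See [jmapP] and [jmap_unique]. *)
Definition jmap (Z : g) : 'End(subvs_of v) :=
  xget 0 [set J : 'End(subvs_of v) | forall V W : subvs_of v,
    ip Z (br (vsval V) (vsval W)) = ip (vsval (J V)) (vsval W)].

Let ipv (x y : subvs_of v) := ip (vsval x) (vsval y).

Let ipv_linl y : scalar (ipv ^~ y).
Proof. by move=> a x w; rewrite /ipv linearP ip_linl. Qed.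

Let ipv_linr y : scalar (ipv y).
Proof. by move=> a x w; rewrite /ipv linearP. Qed.

Let ipv_def x : ipv x x = 0 -> x = 0.
Proof. by move=> /ip_eq0 x0; apply: val_inj. Qed.

Lemma jmapP (Z : g) (V W : subvs_of v) :
  ip Z (br (vsval V) (vsval W)) = ip (vsval (jmap Z V)) (vsval W).
Proof.
rewrite /jmap; case: xgetP => [J _ /(_ V W)//|].
have [J JP] := @definite_repr_lfun _ _ ipv ipv_linl ipv_linr ipv_def
  (subvs_of v)
  (fun V W => ip Z (br (vsval V) (vsval W)))
  (fun W a x y => ltac:(by rewrite /= linearPl ip_linr))
  (fun V a x y => ltac:(by rewrite /= linearPr ip_linr)).
by case/(_ J) => x y; rewrite -JP.
Qed.

Lemma jmap_unique (Z : g) (J : 'End(subvs_of v)) :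
  (forall V W : subvs_of v,
    ip Z (br (vsval V) (vsval W)) = ip (vsval (J V)) (vsval W)) ->
  J = jmap Z.
Proof.
move=> JP; apply/lfunP => x; apply: (addrI (- jmap Z x)); rewrite addNr.
rewrite -scaleN1r; apply: ipv_def.
by rewrite ipv_linl /ipv -JP -jmapP mulN1r addNr.
Qed.

Lemma jmap_so (Z : g) : so ip (jmap Z).
Proof.
move=> x y; rewrite -jmapP [in RHS]ipC -jmapP.
suff -> : br (vsval x) (vsval y) = - br (vsval y) (vsval x) by rewrite linearNr.
apply/eqP; rewrite -addr_eq0; apply/eqP.
have := lie_alt br (vsval x + vsval y).
by rewrite linearDl !linearDr !lie_alt add0r addr0.
Qed.

(* An endomorphism of v extended by 0 on z. *)
Definition extend0 (A : 'End(subvs_of v)) (x : g) : g :=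
  vsval (A (vsproj v (daddv_pi v z x))).

Lemma orthov_center_cap : (v :&: z = 0)%VS.
Proof.
apply/eqP; rewrite -subv0; apply/subvP => x; rewrite memv_cap memv0.
by case/andP => /mem_orthovP xv xz; apply/eqP/(@ip_eq0 _ _ ip)/xv.
Qed.

Lemma orthov_center_add : (v + z)%VS = fullv.
Proof.
apply/eqP; rewrite eqEsubv subvf andTb; apply/subvP => x _.
pose b (p r : subvs_of z) := ip (vsval p) (vsval r).
have [p pP] := @definite_repr _ _ b
  (fun r a p p' => ltac:(by rewrite /b /= linearPl))
  (fun r a p p' => ltac:(by rewrite /b /= ip_linr))
  (fun p pp => ltac:(by apply: val_inj; exact: (ip_eq0 pp)))
  (fun r => ip x (vsval r)) (fun a r r' => ltac:(by rewrite /= ip_linr)).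
rewrite -(subrK (vsval p) x) memv_add ?subvsP//.
apply/mem_orthovP => w wz; apply/eqP; rewrite linearBl /= subr_eq0; apply/eqP.
by rewrite -(vsprojK wz) -[RHS]/(b p _) pP.
Qed.

Lemma extend0E (A : 'End(subvs_of v)) (V : subvs_of v) (Z : subvs_of z) :
  extend0 A (vsval V + vsval Z) = vsval (A V).
Proof.
have pV : daddv_pi v z (vsval V) = vsval V.
  by rewrite daddv_pi_id ?orthov_center_cap ?subvsP.
have pZ : daddv_pi v z (vsval Z) = 0.
  have := @daddv_pi_add _ _ v z (vsval Z) orthov_center_cap.
  rewrite (@daddv_pi_id _ _ z v) ?subvsP//; last first.
    by rewrite capvC orthov_center_cap.
  by move=> /(_ (subvP (addvSr v z) _ (subvsP Z))) /(canRL (addrK _)) ->; rewrite subrr.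
by rewrite /extend0 linearD /= pV pZ addr0 vsvalK.
Qed.

End TwoStep.

Section Trajectories.
Variables (R : realType) (g : finNormedModType R) (br : lieBracket g).
Variable ip : {dot g for idfun}.

Definition magnetic_trajectory (q : R) (F : g -> g) (x : R -> g) : Prop :=
  forall t : R, is_derive t 1 x (adjoint ip (ad br (x t)) (x t) + q *: F (x t)).

Definition geodesic (x : R -> g) : Prop :=
  forall t : R, is_derive t 1 x (adjoint ip (ad br (x t)) (x t)).

End Trajectories.

(* Main.v *)
Require Import Defs.
From mathcomp Require Import all_boot all_order all_algebra.
From mathcomp Require Import sesquilinear.
From mathcomp Require Import boolp classical_sets reals topology normedtype derive.
From mathcomp Require Import realfun.
From mathcomp Require Import ring.
Import Order.TTheory GRing.Theory Num.Theory.
Import numFieldNormedType.Exports.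
Local Open Scope ring_scope.

(** Since brackets are central and the center is orthogonal to v, the quadratic
    field x |-> ad(x)^* x at x = V + Z is just j(Z) V ([adjoint_adE]).  As j is
    linear, switching on the force q j(Zt) replaces j(Z) V by j(q Zt + Z) V
    ([magnetic_fieldE]): a magnetic trajectory is a geodesic whose central part
    has been shifted by q Zt, which is the equivalence of (i) and (ii).

    These fields all take values in v.  Pairing a solution with a vector of the
    center therefore gives a real function with zero derivative
    ([orth_derive_cst]), so the central part is a constant Z0 and the remaining
    part satisfies the linear equation v' = j(q Zt + Z0) v.  Conversely, for
    v' = j(Z) v with Z central, a suitable force is obtained by solving
    q Zt + Z0 = Z.  The solution q^-1 (Z - Z0) may fail to lie in the
    commutator, but j vanishes on the orthogonal complement of the commutator,
    so its orthogonal projection has the same image under j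
    ([jmap_commutator_repr]). *)

(** * Inner products and orthogonal decompositions *)

Section InnerProductTheory.
Context {R : realType} {g : vectType R} (ip : {dot g for idfun}).

Lemma ip_ge0 (x : g) : 0 <= ip x x.
Proof.
have [->|/(@neq0_dnorm_gt0 _ _ _ ip)/ltW//] := eqVneq x 0.
by rewrite linear0l.
Qed.

Lemma ip_inj (x y : g) : (forall w, ip x w = ip y w) -> x = y.
Proof.
move=> xy; apply/eqP; rewrite -subr_eq0; apply/eqP/(@ip_eq0 _ _ ip).
by rewrite linearBl /= xy subrr.
Qed.

(** The orthogonal projection onto U: it represents the restriction to U of the
    functional [ip x], which is possible because [ip] is definite on U. *)
Lemma orth_decomp (U : {vspace g}) (x : g) :
  exists2 p, p \in U & x - p \in orthov ip U.
Proof.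
have [p pP] := @definite_repr _ (subvs_of U) (fun p r => ip (vsval p) (vsval r))
  (fun r a p p' => ltac:(by rewrite /= linearPl))
  (fun r a p p' => ltac:(by rewrite /= ip_linr))
  (fun p pp => ltac:(by apply: val_inj; exact: (ip_eq0 pp)))
  (fun r => ip x (vsval r)) (fun a r r' => ltac:(by rewrite /= ip_linr)).
exists (vsval p); first exact: subvsP.
apply/mem_orthovP => w wU; rewrite linearBl /= -(vsprojK wU).
by rewrite pP subrr.
Qed.

End InnerProductTheory.

(** * The map j of a metric Lie algebra *)

Section MetricLieAlgebra.
Context {R : realType} {g : vectType R} (ip : {dot g for idfun}).
Context (br : lieBracket g).
Local Notation v := (orthov ip (lie_center br)).
Local Notation z := (lie_center br).

Lemma lie_anticomm (x y : g) : br x y = - br y x.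
Proof.
apply/eqP; rewrite -addr_eq0; apply/eqP.
have := lie_alt br (x + y).
by rewrite linearDl !linearDr !lie_alt add0r addr0.
Qed.

Lemma mem_bracket x y : br x y \in lie_commutator br.
Proof. exact: (lie_commutatorP br _ (subvv _)). Qed.

Lemma orth_decomp_unique (V V' : subvs_of v) (Z Z' : subvs_of z) :
  vsval V + vsval Z = vsval V' + vsval Z' -> V = V' /\ Z = Z'.
Proof.
move=> e.
have e' : vsval (V - V') = vsval (Z' - Z).
  rewrite !linearB /=; apply/eqP; rewrite subr_eq addrAC.
  by rewrite [vsval Z' + _]addrC -e addrK.
have VV : V - V' = 0.
  apply/val_inj/eqP; rewrite -[val _]/(vsval _) -memv0.
  by rewrite -(orthov_center_cap br ip) memv_cap subvsP e' subvsP.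
split; apply/eqP; rewrite -subr_eq0 ?VV//.
by rewrite -oppr_eq0 opprB; apply/eqP/val_inj; rewrite -[val _]/(vsval _) -e' VV.
Qed.

Lemma jmap_linear a (Z Z' : g) :
  jmap br ip (a *: Z + Z') = a *: jmap br ip Z + jmap br ip Z'.
Proof.
apply/esym/jmap_unique => V W.
by rewrite add_lfunE scale_lfunE linearP !linearPl /= !jmapP.
Qed.

(** The defining identity tests j(Z) only through the pairing of Z with
    brackets. *)
Lemma jmap_orth_commutator (Z : g) :
  Z \in orthov ip (lie_commutator br) -> jmap br ip Z = 0.
Proof.
move=> /mem_orthovP Zo; apply/esym/jmap_unique => V W.
by rewrite Zo ?mem_bracket// zero_lfunE linear0 linear0l.
Qed.

(** Z differs from its orthogonal projection to the commutator by a vector that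
    j kills. *)
Lemma jmap_commutator_repr (Z : g) :
  exists2 Zt, Zt \in lie_commutator br & jmap br ip Zt = jmap br ip Z.
Proof.
have [Zt ZtC ZZt] := orth_decomp ip (lie_commutator br) Z.
exists Zt => //; rewrite -[RHS](congr1 _ (subrK Zt Z)) -[Z - Zt]scale1r.
by rewrite jmap_linear (jmap_orth_commutator _ ZZt) scaler0 add0r.
Qed.

(** * The magnetic field of a 2-step nilpotent Lie algebra *)

Hypothesis nilp2 : two_step_nilpotent br.

Lemma commutator_sub_center : (lie_commutator br <= lie_center br)%VS.
Proof. by apply/lie_commutatorP => x y; apply/lie_centerP; exact: nilp2. Qed.

(** Pairing the left side with w gives <V + Z, [V + Z, w]>.  The terms with
    [Z, w] vanish as Z is central, the pairing of V with the central vector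
    [V, w] vanishes by orthogonality, and <Z, [V, w]> = <j(Z) V, w> remains. *)
Lemma adjoint_adE (V : subvs_of v) (Z : subvs_of z) :
  adjoint ip (ad br (vsval V + vsval Z)) (vsval V + vsval Z)
  = vsval (jmap br ip (vsval Z) V).
Proof.
apply: (ip_inj ip) => w; rewrite ipC -adjointP adE ipC.
have /memv_addP[W Wv [W' W'z ->]] : w \in (v + z)%VS.
  by rewrite orthov_center_add memvf.
rewrite -(vsprojK Wv); move: (vsproj _ W) => {Wv}W.
have /lie_centerP Zc := subvsP Z.
have /mem_orthovP Vo := subvsP V.
rewrite [br (_ + _) _]linearDl /= Zc addr0 linearDr /=.
rewrite (lie_anticomm _ W') (lie_centerP br _ W'z) oppr0 addr0.
rewrite linearDl /= Vo ?(subvP commutator_sub_center) ?mem_bracket//.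
rewrite add0r jmapP linearDr /= [X in _ + X](_ : _ = 0) ?addr0//.
by have /mem_orthovP := subvsP (jmap br ip (vsval Z) V); exact.
Qed.

Lemma magnetic_fieldE (q : R) (Zt : g) (V : subvs_of v) (Z : subvs_of z) :
  adjoint ip (ad br (vsval V + vsval Z)) (vsval V + vsval Z)
    + q *: extend0 (jmap br ip Zt) (vsval V + vsval Z)
  = vsval (jmap br ip (q *: Zt + vsval Z) V).
Proof.
rewrite adjoint_adE extend0E jmap_linear add_lfunE scale_lfunE.
by rewrite addrC linearD linearZ.
Qed.

End MetricLieAlgebra.

(** * Curves with constrained velocity *)

Section Curves.
Local Open Scope classical_set_scope.
Context {R : realType}.

Lemma is_derive_linear (V W : normedModType R) (f : {linear V -> W}) (x : R -> V)
    (t : R) (dx : V) : continuous f ->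
  is_derive t 1 x dx -> is_derive t 1 (f \o x) (f dx).
Proof.
move=> cf [dx1 dx2].
pose d (h : R) := h^-1 *: ((x \o shift t) (h *: 1) - x t).
have fd : f \o d =
    (fun h : R => h^-1 *: ((f \o x \o shift t) (h *: 1) - (f \o x) t)).
  by apply/funext => h; rewrite /d/= linearZ/= linearB.
have h : (fun h : R => h^-1 *: ((f \o x \o shift t) (h *: 1) - (f \o x) t))
     @ 0^' --> f dx.
  rewrite -fd; apply: (@cvg_comp _ _ _ d f _ (nbhs dx)); last exact: cf.
  by rewrite -dx2; exact: dx1.
by apply: DeriveDef; [apply/cvg_ex; exists (f dx) | exact/cvg_lim].
Qed.

Lemma is_derive_translate (V : normedModType R) (x : R -> V) (c : V) (t : R)
    (dx : V) : is_derive t 1 x dx -> is_derive t 1 (fun s => x s + c) dx.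
Proof.
by move=> dxt; rewrite -[dx]addr0; apply: is_deriveD.
Qed.

Context {g : finNormedModType R} (ip : {dot g for idfun}).
Hypothesis norm_ip : forall x : g, `|x| = Num.sqrt (ip x x).

(** By polarization the inner product is a polynomial in norms, and norms are
    continuous. *)
Lemma ip_continuous (w : g) : continuous (ip w : g -> R^o).
Proof.
have -> : (ip w : g -> R) =
    fun x => 2^-1 * (`|w + x| ^+ 2 - `|x| ^+ 2 - `|w| ^+ 2).
  apply/funext => x; rewrite !norm_ip !sqr_sqrtr ?ip_ge0//.
  rewrite linearDl !linearDr /= (ipC _ x w); by field.
move=> x; apply: cvgM; first exact: cvg_cst.
apply: cvgB; last exact: cvg_cst.
apply: cvgB; apply: cvgM; apply: cvg_norm; do ?exact: cvg_id.
all: by apply: cvgD; [exact: cvg_cst | exact: cvg_id].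
Qed.

(** A curve whose velocity stays orthogonal to w moves inside an affine
    hyperplane orthogonal to w. *)
Lemma orth_derive_cst (w : g) (y dy : R -> g) :
  (forall t : R, is_derive t 1 y (dy t)) -> (forall t, ip w (dy t) = 0) ->
  forall s t, ip w (y s) = ip w (y t).
Proof.
move=> y' wdy s t; apply: (@is_derive_0_is_cst _ (ip w \o y)) => r.
rewrite -(wdy r).
exact: (@is_derive_linear g R^o (ip w) _ _ _ (ip_continuous w)).
Qed.

End Curves.

(** * Magnetic trajectories, shifted geodesics and the linear equation *)

Theorem theorem3p3 (R : realType) (n : finNormedModType R)
    (br : lieBracket n) (ip : {dot n for idfun})
    (norm_ip : forall x : n, `|x| = Num.sqrt (ip x x))
    (nilp2 : two_step_nilpotent br)
    (q : R) (q_neq0 : q != 0)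
    (v : R -> subvs_of (orthov ip (lie_center br)))
    (z : R -> subvs_of (lie_center br))
    (y : R -> n)
    (yE : forall t : R, y t = vsval (v t) + vsval (z t))
    (y_diff : forall t : R, derivable y t 1)
    (X0 : subvs_of (orthov ip (lie_center br)))
    (Z0 : subvs_of (lie_center br))
    (y0 : y 0 = vsval X0 + vsval Z0) :
  [<->
    (* (i) *)
    exists2 Zt : n, Zt \in lie_commutator br &
      magnetic_trajectory br ip q (extend0 (jmap br ip Zt)) y;
    (* (ii) *)
    exists2 Zt : n, Zt \in lie_commutator br &
      exists x : R -> n,
        [/\ geodesic br ip x,
            x 0 = vsval X0 + vsval Z0 + q *: Zt
          & forall t : R, y t = x t - q *: Zt];
    (* (iii) *)
    (forall t : R, z t = Z0) /\
    exists A : 'End(subvs_of (orthov ip (lie_center br))),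
      [/\ so ip A,
          forall t : R, is_derive t 1 (fun s : R => vsval (v s)) (vsval (A (v t)))
        & exists2 Z : n, Z \in lie_center br & A = jmap br ip Z]
  ].
Proof.
have sCz := subvP (commutator_sub_center br nilp2).
have [v0 z0] : v 0 = X0 /\ z 0 = Z0.
  by apply: (orth_decomp_unique ip br); rewrite -yE.
(* The geodesic field at the shifted point is the magnetic field at [y t]. *)
have shiftE Zt t : Zt \in lie_commutator br ->
    adjoint ip (ad br (y t + q *: Zt)) (y t + q *: Zt)
    = vsval (jmap br ip (q *: Zt + vsval (z t)) (v t)).
  move=> ZtC; pose Zs := q *: vsproj (lie_center br) Zt + z t.
  have ZsE : vsval Zs = q *: Zt + vsval (z t).
    by rewrite linearD linearZ /= vsprojK// sCz.
  by rewrite yE -addrA [_ + q *: _]addrC -ZsE adjoint_adE.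
split.
  case=> Zt ZtC y'; exists Zt => //; exists (fun t => y t + q *: Zt).
  split; [|by rewrite y0|by move=> t; rewrite addrK].
  move=> t; rewrite shiftE// -magnetic_fieldE// -yE.
  exact: is_derive_translate.
split.
  case=> Zt ZtC [x [x' x0 yx]].
  have y' (t : R) :
      is_derive t 1 y (vsval (jmap br ip (q *: Zt + vsval (z t)) (v t))).
    rewrite -shiftE// yx subrK (funext yx).
    exact: is_derive_translate.
  have zE t : z t = Z0.
    apply/eqP; rewrite -z0 -subr_eq0; apply/eqP/val_inj/(@ip_eq0 _ _ ip).
    rewrite -[val _]/(vsval _); set w := vsval (z t - z 0).
    have wip (u : subvs_of (orthov ip (lie_center br))) : ip w (vsval u) = 0.
      by rewrite ipC; have /mem_orthovP := subvsP u; apply; exact: subvsP.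
    (* The pairing of [w] with [y], which is its pairing with [z], is constant;
       so [w] is orthogonal to [z t - z 0], that is, to itself. *)
    have := @orth_derive_cst _ _ ip norm_ip w y _ y' (fun s => wip _) t 0.
    have wy s : ip w (y s) = ip w (vsval (z s)).
      by rewrite yE linearDr /= wip add0r.
    rewrite !wy => wz.
    by rewrite [X in ip w X]linearB linearBr /= wz subrr.
  split=> //; exists (jmap br ip (q *: Zt + vsval Z0)); split.
  - exact: jmap_so.
  - move=> t; rewrite -(zE t).
    have -> : (fun s => vsval (v s)) = (fun s => y s + - vsval Z0).
      by apply/funext => s; rewrite yE zE addrK.
    exact: is_derive_translate.
  - by exists (q *: Zt + vsval Z0) => //; rewrite memvD ?subvsP// memvZ ?sCz.
case=> zE [A [_ v' [Z _ AE]]].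
have [Zt ZtC ZtE] := jmap_commutator_repr ip br (q^-1 *: (Z - vsval Z0)).
exists Zt => // t; rewrite yE magnetic_fieldE// zE jmap_linear ZtE.
rewrite -jmap_linear scalerA divff// scale1r subrK -AE.
have -> : y = (fun s => vsval (v s) + vsval Z0).
  by apply/funext => s; rewrite yE zE.
exact: is_derive_translate.
Qed.
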